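(* Let $(R,\mathfrak m)$ be a Cohen-Macaulay local ring of dimension two with infinite residue field, let $I,J$ be $\mathfrak m$-primary ideals of $R$, and let $(a,b)$ be a joint reduction of $I$ and $J$. Let $r_0,s_0\ge0$ be integers. Then the following statements are equivalent: (a) for all $k\gg0$, $I^{r_0+k}J^{s_0+k}=a^kI^{r_0}J^{s_0+k}+b^kI^{r_0+k}J^{s_0}$; (b) $e_{(0,1)}=g_1(r_0)+r_0e_{(1,1)}$, $e_{(1,0)}=h_1(s_0)+s_0e_{(1,1)}$ and $$e_2(IJ)=g_2(r_0)+h_2(s_0)-\ell(R/I^{r_0}J^{s_0})+r_0s_0e_{(1,1)}+\ell\left(\frac{\widetilde{\mathcal F}_{(a,b)}(I^{r_0},J^{s_0})}{I^{r_0}J^{s_0}}\right);$$ (c) $M^1_{r_0,s_0}(a^k,b^k)=0$ for all $k\gg0$.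
   Context: $\ell$ denotes length of $R$-modules, and $I^0=J^0=R$. A pair $(a,b)$ is a joint reduction of $I$ and $J$ if $a\in I$, $b\in J$ and $I^{r+1}J^{s+1}=aI^rJ^{s+1}+bI^{r+1}J^s$ for all large $r,s$. For $r,s\ge 0$, $k\ge1$: $M^1_{r,s}(a^k,b^k):=\dfrac{I^{r+k}J^{s+k}}{a^kI^rJ^{s+k}+b^kI^{r+k}J^s}$, and $\widetilde{\mathcal F}_{(a,b)}(I^r,J^s):=\bigcup_{k\ge1}\big((I^{r+k}J^s:a^k)\cap(I^rJ^{s+k}:b^k)\big)$. Hilbert coefficients: for an $\mathfrak m$-primary ideal $K$, $\ell(R/K^n)=e_0(K)\binom{n+1}{2}-e_1(K)n+e_2(K)$ for $n\gg0$. Bigraded Hilbert coefficients $e_{(i,j)}$ of $\{I^rJ^s\}$: $\ell(R/I^rJ^s)=\sum_{i+j\le 2}(-1)^{i+j}e_{(i,j)}\binom{r+i-1}{i}\binom{s+j-1}{j}$ for all $r,s\gg0$. For each fixed $r\ge0$ there are integers $g_1(r),g_2(r)$ with $\ell(R/I^rJ^s)=e_0(J)\binom{s+1}{2}-g_1(r)s+g_2(r)$ for all $s\gg0$; for each fixed $s\ge0$ there are integers $h_1(s),h_2(s)$ with $\ell(R/I^rJ^s)=e_0(I)\binom{r+1}{2}-h_1(s)r+h_2(s)$ for all $r\gg0$. *)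

(* Defs.v *)
From HB Require Import structures.
From mathcomp Require Import all_boot all_order all_algebra.
From mathcomp Require Import boolp classical_sets cardinality constructive_ereal.

Set Implicit Arguments.
Unset Strict Implicit.
Unset Printing Implicit Defensive.

Import GRing.Theory.
Local Open Scope ring_scope.
Local Open Scope quotient_scope.

(* MathComp's [submodClosed] does not give closure under opposite, which the
   quotient needs, and its [idealr] are proper ideals, whereas I^0 = R; hence
   this bundled type. *)
Record submod (R : comNzRingType) (M : lmodType R) := Submod {
  submod_pred :> {pred M};
  submodP : submod_closed submod_pred }.

HB.instance Definition _ (R : comNzRingType) (M : lmodType R) (N : submod M) :=
  GRing.isSubmodClosed.Build R M (submod_pred N) (submodP N).

Notation ideal R := (submod R^o).

Section Quotient.
Variables (R : comNzRingType) (M : lmodType R).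

Definition submod_type (N : submod M) : Type := {x : M | x \in submod_pred N}.

HB.instance Definition _ N := SubChoice.on (submod_type N).
HB.instance Definition _ N := [SubChoice_isSubLmodule of submod_type N by <:].

Definition quotm (N : submod M) : Type := Quotient.quot (submod_pred N).

HB.instance Definition _ N := ZmodQuotient.on (quotm N).

Definition quotm_scale N (c : R) (x : quotm N) : quotm N :=
  \pi_(quotm N) (c *: repr x).

Lemma quotm_scaleE N c (x : M) :
  quotm_scale c (\pi_(quotm N) x : quotm N) =
  \pi_(quotm N) (c *: x).
Proof.
apply/eqP; rewrite -Quotient.idealrBE -scalerBr rpredZ //.
by rewrite Quotient.idealrBE reprK.
Qed.

Lemma quotm_scaleA N c d (x : quotm N) :
  quotm_scale c (quotm_scale d x) = quotm_scale (c * d) x.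
Proof.
rewrite -[x]reprK (quotm_scaleE N d (repr x)) (quotm_scaleE N c) scalerA.
by rewrite quotm_scaleE.
Qed.

Lemma quotm_scale1 N : left_id 1 (@quotm_scale N).
Proof. by move=> x; rewrite -[x]reprK quotm_scaleE scale1r. Qed.

Lemma quotm_scaleDr N : right_distributive (@quotm_scale N) +%R.
Proof.
move=> c x y; rewrite -[x]reprK -[y]reprK -[_ + _]raddfD !quotm_scaleE.
by rewrite -[RHS]raddfD scalerDr.
Qed.

Lemma quotm_scaleDl N (x : quotm N) :
  {morph (@quotm_scale N)^~ x : c d / c + d}.
Proof.
move=> c d; rewrite -[x]reprK !quotm_scaleE.
by rewrite -[RHS]raddfD scalerDl.
Qed.

HB.instance Definition _ N := GRing.Zmodule_isLmodule.Build R (quotm N)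
  (@quotm_scaleA N) (@quotm_scale1 N) (@quotm_scaleDr N) (@quotm_scaleDl N).

End Quotient.

Section Subquotient.
Variables (R : comNzRingType) (M : lmodType R).

Lemma submod_restr_closed (A B : submod M) :
  submod_closed [pred x : submod_type A | val x \in B].
Proof.
split=> [|c x y]; rewrite !inE ?raddf0 ?rpred0 // => Bx By.
by rewrite linearP rpredD // rpredZ.
Qed.

Definition submod_restr (A B : submod M) : submod (submod_type A) :=
  Submod (submod_restr_closed A B).

(* A / (A :&: B), that is, A / B when B is contained in A. *)
Definition subquot (A B : submod M) : Type := quotm (submod_restr A B).

HB.instance Definition _ A B := GRing.Lmodule.on (subquot A B).

End Subquotient.

Definition is_maximum (P : nat -> Prop) n :=
  P n /\ forall m, P m -> (m <= n)%N.

(* C 0 < C 1 < ... < C n, a chain of length n of submodules with property P;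
   the values C i for i > n are irrelevant. *)
Definition has_chain (R : comNzRingType) (M : lmodType R)
    (P : submod M -> Prop) (n : nat) :=
  exists C : nat -> submod M,
    (forall i, (i <= n)%N -> P (C i)) /\
    (forall i, (i < n)%N ->
       {subset C i <= C i.+1} /\ ~ {subset C i.+1 <= C i}).

(* The supremum of the lengths of chains of submodules, +oo if unbounded. *)
Definition modlength (R : comNzRingType) (M : lmodType R) : \bar int :=
  xget +oo%E [set l | exists2 n : nat,
    l = n%:Z%:E & is_maximum (@has_chain R M (fun=> True)) n].

Section Ideals.
Variable R : comNzRingType.
Implicit Types (I J K : ideal R) (a b c x y : R).

Lemma idealT_closed : submod_closed (predT : {pred R^o}).
Proof. by []. Qed.
Definition idealT : ideal R := Submod idealT_closed.

Definition ideal_gen_pred (s : seq R) : {pred R^o} :=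
  [pred x : R^o | `[< exists c : nat -> R,
    x = \sum_(i < size s) c i * s`_i >]].
Lemma ideal_gen_closed s : submod_closed (ideal_gen_pred s).
Proof.
split=> [|a x y].
  by apply/asboolP; exists (fun=> 0); rewrite big1 // => i _; rewrite mul0r.
move=> /asboolP[c ->] /asboolP[d ->]; apply/asboolP.
exists (fun i => a * c i + d i).
rewrite [_ *: _]mulr_sumr -big_split; apply: eq_bigr => i _ /=.
by rewrite mulrA -mulrDl.
Qed.
Definition ideal_gen s : ideal R := Submod (ideal_gen_closed s).

Definition idealD_pred I J : {pred R^o} :=
  [pred x : R^o | `[< exists y z, [/\ y \in I, z \in J & x = y + z] >]].
Lemma idealD_closed I J : submod_closed (idealD_pred I J).
Proof.
split=> [|a x y].
  by apply/asboolP; exists 0, 0; split; rewrite ?addr0 //; apply: rpred0.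
move=> /asboolP[u [v [uI vJ ->]]] /asboolP[w [z [wI zJ ->]]]; apply/asboolP.
exists (a * u + w), (a * v + z); split; last by rewrite addrACA -mulrDr.
  by apply: rpredD => //; apply: rpredZ.
by apply: rpredD => //; apply: rpredZ.
Qed.
Definition idealD I J : ideal R := Submod (idealD_closed I J).

Definition idealM_pred I J : {pred R^o} :=
  [pred x : R^o | `[< exists2 s : seq (R * R),
    {in s, forall p, p.1 \in I /\ p.2 \in J} &
    x = \sum_(p <- s) p.1 * p.2 >]].
Lemma idealM_closed I J : submod_closed (idealM_pred I J).
Proof.
split=> [|a x y].
  by apply/asboolP; exists [::]; rewrite ?big_nil.
move=> /asboolP[s sP ->] /asboolP[t tP ->]; apply/asboolP.
exists ([seq (a * p.1, p.2) | p <- s] ++ t) => [p|].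
  rewrite mem_cat => /orP[/mapP[q /sP[q1 q2] ->]|/tP//].
  by split=> //=; apply: rpredZ.
rewrite big_cat big_map /= [_ *: _]mulr_sumr; congr (_ + _).
by apply: eq_bigr => p _; rewrite mulrA.
Qed.
Definition idealM I J : ideal R := Submod (idealM_closed I J).

Definition idealX I n : ideal R := iter n (idealM I) idealT.

Lemma idealXMl I J n a x :
  a \in I -> x \in idealM (idealX I n) J -> a * x \in idealM (idealX I n.+1) J.
Proof.
move=> aI /asboolP[s sP ->]; apply/asboolP.
exists [seq (a * p.1, p.2) | p <- s]; last first.
  by rewrite mulr_sumr big_map; apply: eq_bigr => p _; rewrite mulrA.
move=> _ /mapP[p /sP[p1 p2] ->]; split=> //; apply/asboolP.
exists [:: (a, p.1)]; last by rewrite big_seq1.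
by move=> q; rewrite inE => /eqP ->.
Qed.

Lemma idealXMr I J n b x :
  b \in J -> x \in idealM I (idealX J n) -> b * x \in idealM I (idealX J n.+1).
Proof.
move=> bJ /asboolP[s sP ->]; apply/asboolP.
exists [seq (p.1, b * p.2) | p <- s]; last first.
  by rewrite mulr_sumr big_map; apply: eq_bigr => p _; rewrite mulrCA.
move=> _ /mapP[p /sP[p1 p2] ->]; split=> //; apply/asboolP.
exists [:: (b, p.2)]; last by rewrite big_seq1.
by move=> q; rewrite inE => /eqP ->.
Qed.

Definition idealZ_pred a I : {pred R^o} :=
  [pred x : R^o | `[< exists2 y, y \in I & x = a * y >]].
Lemma idealZ_closed a I : submod_closed (idealZ_pred a I).
Proof.
split=> [|c x y].
  by apply/asboolP; exists 0; rewrite ?mulr0 //; apply: rpred0.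
move=> /asboolP[u uI ->] /asboolP[v vI ->]; apply/asboolP.
exists (c *: u + v); first by apply: rpredD => //; apply: rpredZ.
by rewrite mulrDr; congr (_ + _); apply: mulrCA.
Qed.
Definition idealZ a I : ideal R := Submod (idealZ_closed a I).

Definition colon_pred I a : {pred R^o} := [pred x : R^o | a * x \in I].
Lemma colon_closed I a : submod_closed (colon_pred I a).
Proof.
split=> [|c x y]; rewrite !inE.
  by rewrite mulr0; apply: rpred0.
move=> xI yI; rewrite mulrDr; apply: rpredD => //.
rewrite (_ : a * (c *: x) = c *: (a * x : R^o)); last exact: mulrCA.
exact: rpredZ.
Qed.
Definition colon I a : ideal R := Submod (colon_closed I a).

Definition idealI_pred I J : {pred R^o} :=
  [pred x : R^o | (x \in I) && (x \in J)].
Lemma idealI_closed I J : submod_closed (idealI_pred I J).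
Proof.
split=> [|c x y].
  by rewrite inE; apply/andP; split; apply: rpred0.
rewrite !inE => /andP[xI xJ] /andP[yI yJ].
by apply/andP; split; apply: rpredD => //; apply: rpredZ.
Qed.
Definition idealI I J : ideal R := Submod (idealI_closed I J).

End Ideals.

Declare Scope ideal_scope.
Delimit Scope ideal_scope with ID.
Bind Scope ideal_scope with submod.
Notation "I * J" := (idealM I J) : ideal_scope.
Notation "I ^+ n" := (idealX I n) : ideal_scope.
Notation "I + J" := (idealD I J) : ideal_scope.
Notation "I :&: J" := (idealI I J) : ideal_scope.
Notation "a *: I" := (idealZ a%R I) : ideal_scope.
Notation "I :/ a" := (colon I a%R) (at level 45) : ideal_scope.

Section CommutativeAlgebra.
Variable R : comNzRingType.
Implicit Types I J K P Q m : ideal R.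

Definition noetherian := forall I, exists s : seq R, I =i ideal_gen s.

Definition maximal m :=
  1 \notin m /\ forall I, {subset m <= I} -> 1 \notin I -> I =i m.

Definition is_local m := maximal m /\ forall m', maximal m' -> m' =i m.

Definition prime_ideal P := 1 \notin P /\ prime_idealr_closed P.

Definition krull_dim : nat -> Prop := is_maximum (has_chain prime_ideal).

Definition regular_seq (s : seq R) :=
  1 \notin ideal_gen s /\
  forall i x, (i < size s)%N ->
    s`_i * x \in ideal_gen (take i s) -> x \in ideal_gen (take i s).

Definition depth m : nat -> Prop := is_maximum (fun n =>
  exists s, [/\ size s = n, {in s, forall x, x \in m} & regular_seq s]).

Definition cohen_macaulay m := exists2 d, krull_dim d & depth m d.

Definition primary Q :=
  1 \notin Q /\
  forall x y, x * y \in Q -> x \in Q \/ exists n, y ^+ n \in Q.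

Definition primary_to m Q :=
  primary Q /\ forall x, x \in m <-> exists n, x ^+ n \in Q.

End CommutativeAlgebra.

Record joint_reduction (R : comNzRingType) (I J : ideal R) (a b : R) : Prop := {
  joint_reductionl : a \in I;
  joint_reductionr : b \in J;
  joint_reduction_eq : exists N, forall r s, (N <= r)%N -> (N <= s)%N ->
    (I ^+ r.+1 * J ^+ s.+1 =i
     a *: (I ^+ r * J ^+ s.+1) + b *: (I ^+ r.+1 * J ^+ s))%ID }.

Section JointReduction.
Variables (R : comNzRingType) (I J : ideal R) (a b : R).

Definition M1 (r s k : nat) : Type :=
  subquot (I ^+ (r + k) * J ^+ (s + k))%ID
    (a ^+ k *: (I ^+ r * J ^+ (s + k))
     + b ^+ k *: (I ^+ (r + k) * J ^+ s))%ID.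

HB.instance Definition _ r s k := GRing.Lmodule.on (M1 r s k).

Definition Ftilde_at (r s k : nat) : ideal R :=
  (((I ^+ (r + k) * J ^+ s) :/ a ^+ k) :&:
   ((I ^+ r * J ^+ (s + k)) :/ b ^+ k))%ID.

Definition Ftilde_pred (r s : nat) : {pred R^o} :=
  [pred x : R^o | `[< exists2 k : nat, (1 <= k)%N & x \in Ftilde_at r s k >]].

Hypothesis abred : joint_reduction I J a b.

Lemma Ftilde_at_sub r s k l :
  (k <= l)%N -> {subset Ftilde_at r s k <= Ftilde_at r s l}.
Proof.
move=> /subnK <-; elim: (l - k)%N => // n IHn x /IHn.
rewrite addSn; move: (n + k)%N => d; rewrite !inE => /andP[uP vP].
rewrite !exprS -!mulrA !addnS; apply/andP; split.
  exact: idealXMl (joint_reductionl abred) uP.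
exact: idealXMr (joint_reductionr abred) vP.
Qed.

Lemma Ftilde_closed r s : submod_closed (Ftilde_pred r s).
Proof.
split=> [|c x y].
  by apply/asboolP; exists 1%N => //; apply: rpred0.
move=> /asboolP[k k1 xk] /asboolP[l l1 yl]; apply/asboolP.
exists (maxn k l); first by rewrite leq_max k1.
apply: rpredD; first apply: rpredZ.
  by apply: Ftilde_at_sub xk; apply: leq_maxl.
by apply: Ftilde_at_sub yl; apply: leq_maxr.
Qed.

Definition Ftilde r s : ideal R := Submod (Ftilde_closed r s).

End JointReduction.

Section Hilbert.
Variable R : comNzRingType.
Implicit Types I J K : ideal R.

(* The coefficients are determined by the relations below, so they are
   specified by predicates rather than chosen. *)

Definition hilbert_coeffs K (e : nat -> int) :=
  exists N, forall n, (N <= n)%N ->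
    modlength (quotm (K ^+ n)%ID) =
    (e 0%N * 'C(n.+1, 2)%:Z - e 1%N * n%:Z + e 2%N)%:E.

(* Only the values e i j with i + j <= 2 matter. *)
Definition bigraded_hilbert_coeffs I J (e : nat -> nat -> int) :=
  exists N, forall r s, (N <= r)%N -> (N <= s)%N ->
    modlength (quotm (I ^+ r * J ^+ s)%ID) =
    (\sum_(i < 3) \sum_(j < 3 | (i + j <= 2)%N)
       (-1) ^+ (i + j) * e i j
         * 'C((r + i).-1, i)%:Z * 'C((s + j).-1, j)%:Z)%:E.

End Hilbert.

(* Main.v *)
(* For ideals L, N and a pair (c, d) with vanishing first Koszul homology,
     l(R/(cL + dN)) = l(R/(c, d)) + l(R/L) + l(R/N) - l(R/((L : d) & (N : c))).
   Regular sequences in m of length two, some powers of which lie in (a, b),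
   make (a^k, b^k) such a pair, and l(R/(a^k, b^k)) = k^2 lam with
   lam = l(R/(a, b)).  With c = a^k, d = b^k the formula computes the length of
   M^1_{r0,s0}(a^k, b^k) for large k; once lam = e_(1,1) is known, it equals
     (s0 + k) A + (r0 + k) B + C,
   where A = e_(0,1) - g_1(r0) - r0 e_(1,1), B = e_(1,0) - h_1(s0) - s0 e_(1,1)
   and C is the difference of the two sides of the last equation of (b).
   So (b) forces the length to vanish.  Conversely, vanishing for all large k
   gives A + B = 0, and A = B = C = 0 follows from A, B >= 0.  The latter come
   from the bound l(R/I^(r+k)J^s) <= l(R/I^rJ^s) + k lam s + O(1), by comparing
   coefficients of s.  For large r the same bound gives e_(1,1) <= lam, while
   the formula with k = 1, where the quotient vanishes because (a, b) is a
   joint reduction, gives lam <= e_(1,1). *)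
Require Import Defs.
From HB Require Import structures.
From mathcomp Require Import all_boot all_order all_algebra.
From mathcomp Require Import boolp classical_sets cardinality constructive_ereal.
From mathcomp Require Import zify ring.

Set Implicit Arguments.
Unset Strict Implicit.
Unset Printing Implicit Defensive.

Import Order.TTheory GRing.Theory Num.Theory.
Local Open Scope ring_scope.

(** * Chains of submodules between two bounds *)

Section Chains.
Variables (R : comNzRingType) (M : lmodType R).
Implicit Types (A B C X Y : submod M) (P : submod M -> Prop).

(** Function extensionality and proof irrelevance make extensional equality usable for rewriting. *)
Lemma submod_ext A B : A =i B -> A = B.
Proof.
case: A B => [p Pp] [q Pq] /= eqpq.
have e : p = q by apply: funext => x; have := eqpq x.
by case: _ / e Pq eqpq => Pq _; congr Submod; apply: Prop_irrelevance.
Qed.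

Lemma submod_anti A B : {subset A <= B} -> {subset B <= A} -> A = B.
Proof.
by move=> AB BA; apply: submod_ext => x; apply/idP/idP; [apply: AB|apply: BA].
Qed.

Definition between A B X := {subset A <= X} /\ {subset X <= B}.

(** The length of B/A, expressed without forming the quotient. *)
Definition is_len A B n := is_maximum (has_chain (between A B)) n.

Lemma is_maximum_uniq (Q : nat -> Prop) n p :
  is_maximum Q n -> is_maximum Q p -> n = p.
Proof.
by move=> [Qn maxn] [Qp maxp]; apply/eqP; rewrite eqn_leq maxn // maxp.
Qed.

Lemma bounded_is_maximum (Q : nat -> Prop) n0 b :
  Q n0 -> (forall n, Q n -> (n <= b)%N) -> exists n, is_maximum Q n.
Proof.
move=> Q0 Qb; have exQ : exists n, `[< Q n >] by exists n0; apply/asboolP.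
have leQ n : `[< Q n >] -> (n <= b)%N by move/asboolP; apply: Qb.
case: (ex_maxnP exQ leQ) => n /asboolP Qn maxn; exists n; split=> // p Qp.
by apply: maxn; apply/asboolP.
Qed.

Lemma has_chain0 A B : {subset A <= B} -> has_chain (between A B) 0.
Proof. by move=> AB; exists (fun=> A); split=> // i _; split. Qed.

Lemma has_chain_mono A B A' B' n :
    {subset A' <= A} -> {subset B <= B'} ->
  has_chain (between A B) n -> has_chain (between A' B') n.
Proof.
move=> AA BB [C [CP Cs]]; exists C; split=> // i /CP[AC CB].
by split=> x; [move/AA/AC | move/CB/BB].
Qed.

Lemma has_chain_cat A B C p q :
    has_chain (between A B) p -> has_chain (between B C) q ->
  has_chain (between A C) (p + q).
Proof.
move=> [X [XP Xs]] [Y [YP Ys]].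
(* The chains need not reach [B], so [Y 0] is dropped: [X p] lies in [B], hence in [Y 0], which is
   strictly smaller than [Y 1]. *)
exists (fun i => if (i <= p)%N then X i else Y (i - p)%N); split=> i Hi.
  case: leqP => ip; split=> x xi.
  - exact: (XP i ip).1.
  - by apply: (YP 0%N isT).2; apply: (YP 0%N isT).1; apply: (XP i ip).2.
  - have := YP (i - p)%N; rewrite leq_subLR => /(_ Hi)[+ _]; apply.
    by apply: (XP p (leqnn p)).2; apply: (XP p (leqnn p)).1.
  - by have := YP (i - p)%N; rewrite leq_subLR => /(_ Hi)[_]; apply.
case: (ltngtP i p) => ip.
- exact: Xs.
- by rewrite subSn ?(ltnW ip)//; apply: Ys; lia.
- rewrite ip subSnn.
  have q0 : (0 < q)%N by lia.
  have [Y01 NY10] := Ys 0%N q0.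
  have XY x : x \in X p -> x \in Y 0%N.
    by move/(XP p (leqnn p)).2; apply: (YP 0%N isT).1.
  split=> [x /XY/Y01//|Y1X]; apply: NY10 => x /Y1X; exact: XY.
Qed.

Lemma has_chain1 A B :
  {subset A <= B} -> ~ {subset B <= A} -> has_chain (between A B) 1.
Proof.
move=> AB nBA; exists (fun i => if i == 0%N then A else B).
by split=> -[|[|i]] //= _; split.
Qed.

End Chains.

(** * Transport of chains along order embeddings and linear maps *)

Lemma has_chain_map (R : comNzRingType) (M M' : lmodType R)
    (P : submod M -> Prop) (P' : submod M' -> Prop)
    (f : submod M -> submod M') n :
    (forall X, P X -> P' (f X)) ->
    (forall X Y, P X -> P Y -> {subset X <= Y} -> {subset f X <= f Y}) ->
    (forall X Y, P X -> P Y -> {subset f X <= f Y} -> {subset X <= Y}) ->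
  has_chain P n -> has_chain P' n.
Proof.
move=> fP fmono finj [C [CP Cs]]; exists (f \o C); split=> i Hi /=.
  exact/fP/CP.
have [CC nCC] := Cs i Hi; have [Pi PSi] := (CP i (ltnW Hi), CP i.+1 Hi).
by split; [apply: fmono | move/finj => /(_ PSi Pi)].
Qed.

Section ChainTransport.
Variables (R : comNzRingType) (M M' : lmodType R).
Variable f : M -> M'.
Hypothesis flin : linear f.

Let f0 : f 0 = 0.
Proof. by have := flin (-1) 0 0; rewrite scaler0 addr0 scaleN1r addNr. Qed.

Lemma submod_preim_closed (Y : submod M') :
  submod_closed [pred x | f x \in Y].
Proof.
split=> [|c x y]; rewrite !inE ?f0 ?rpred0 // => fx fy.
by rewrite flin rpredD // rpredZ.
Qed.
Definition submod_preim Y := Submod (submod_preim_closed Y).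

Lemma submod_image_closed (X : submod M) :
  submod_closed [pred y | `[< exists2 x, x \in X & y = f x >]].
Proof.
split=> [|c _ _ /asboolP[x xX ->] /asboolP[y yX ->]]; apply/asboolP.
  by exists 0; rewrite ?f0 ?rpred0.
by exists (c *: x + y); rewrite ?flin // rpredD // rpredZ.
Qed.
Definition submod_image X := Submod (submod_image_closed X).

(** The correspondence theorem: image and preimage match submodules containing the kernel with
    submodules inside the image. *)
Lemma has_chain_linear (P : submod M -> Prop) (P' : submod M' -> Prop) n :
    (forall X, P X -> P' (submod_image X)) ->
    (forall Y, P' Y -> P (submod_preim Y)) ->
    (forall X x, P X -> f x = 0 -> x \in X) ->
    (forall Y y, P' Y -> y \in Y -> exists x, y = f x) ->
  has_chain P n <-> has_chain P' n.
Proof.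
move=> PP' P'P kerP imP; split.
  apply: (has_chain_map (f := submod_image)) => // X Y PX PY XY x.
    by move=> /asboolP[z /XY zY ->]; apply/asboolP; exists z.
  move=> xX; have /XY/asboolP[y yY fxy] : f x \in submod_image X.
    by apply/asboolP; exists x.
  rewrite -[x](subrK y) rpredD //; apply: kerP => //.
  by rewrite -scaleN1r addrC flin fxy scaleN1r addNr.
apply: (has_chain_map (f := submod_preim)) => // X Y PX PY XY x.
  by rewrite !inE => /XY.
by move=> xX; have [y def_x] := imP X x PX xX; move: xX; rewrite def_x => /XY.
Qed.

End ChainTransport.

(** * Lengths of quotients and subquotients through chains *)

Section ModuleLength.
Variables (R : comNzRingType).

Lemma modlengthE (M : lmodType R) n :
  is_maximum (@has_chain R M (fun=> True)) n -> modlength M = n%:Z%:E.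
Proof.
move=> maxn; rewrite /modlength; apply: xget_unique; first by exists n.
by move=> _ [p -> maxp]; rewrite (is_maximum_uniq maxp maxn).
Qed.

Lemma modlength_fin (M : lmodType R) z : modlength M = z%:E ->
  exists2 n : nat, z = n%:Z & is_maximum (@has_chain R M (fun=> True)) n.
Proof.
by rewrite /modlength; case: xgetP => // l _ [n -> maxn] [<-]; exists n.
Qed.

Lemma quotm_chain (M : lmodType R) (N : submod M) n :
  @has_chain R (quotm N) (fun=> True) n <->
  has_chain (fun X : submod M => {subset N <= X}) n.
Proof.
have pi_lin : linear (fun x : M => \pi_(quotm N)%qT x : quotm N).
  by move=> c x y; rewrite raddfD -[X in X + _]quotm_scaleE.
have pi_eq0 x : x \in N <-> \pi_(quotm N)%qT x = 0 :> quotm N.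
  have <- : \pi_(quotm N)%qT 0 = 0 :> quotm N by apply: raddf0.
  rewrite -[x in X in X <-> _]subr0 Quotient.idealrBE; split=> [/eqP//|->].
  exact: eqxx.
apply: iff_sym; apply: (has_chain_linear (flin := pi_lin)) => //.
- by move=> Y _ x /pi_eq0; rewrite inE => ->; apply: rpred0.
- by move=> X x NX /pi_eq0/NX.
- by move=> Y y _ _; exists (repr y); rewrite reprK.
Qed.

End ModuleLength.

Lemma quotm_has_chain (R : comNzRingType) (M : lmodType R) (N T : submod M) n :
    (forall x, x \in T) ->
  @has_chain R (quotm N) (fun=> True) n <-> has_chain (between N T) n.
Proof.
move=> allT; apply: (iff_trans (quotm_chain N n)).
split=> -[C [CP Cs]]; exists C; split=> // i /CP; last by case.
by split=> // x _; apply: allT.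
Qed.

Lemma subquot_has_chain (R : comNzRingType) (M : lmodType R) (A B : submod M) n :
    {subset B <= A} ->
  @has_chain R (subquot A B) (fun=> True) n <-> has_chain (between B A) n.
Proof.
move=> BA; apply: (iff_trans (quotm_chain _ n)).
have val_lin : linear (fun x : submod_type A => val x : M).
  by move=> c x y; rewrite linearP.
apply: (has_chain_linear (flin := val_lin)).
- move=> X BX; split=> x; last by case/asboolP=> y _ ->; apply: (valP y).
  move=> xB; apply/asboolP; exists (Sub x (BA x xB)); last by rewrite SubK.
  by apply: BX; rewrite inE SubK.
- by move=> Y [BY YA] x; rewrite !inE => /BY.
- by move=> X x BX x0; apply: BX; rewrite inE x0 rpred0.
- by move=> Y y [BY YA] /YA yA; exists (Sub y yA); rewrite SubK.
Qed.

(** Turns the vanishing of [M1] in (c) into an inclusion of ideals. *)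
Lemma subquot_eq0 (R : comNzRingType) (M : lmodType R) (A B : submod M) :
  (forall x : subquot A B, x = 0) <-> {subset A <= B}.
Proof.
have pi_eq0 x : \pi_(subquot A B)%qT x = 0 <-> val x \in B.
  have <- : \pi_(subquot A B)%qT 0 = 0 :> subquot A B by apply: raddf0.
  have -> : (val x \in B) = (x - 0 \in submod_restr A B) by rewrite subr0.
  by rewrite Quotient.idealrBE; split=> [->|/eqP//]; apply: eqxx.
split=> [all0 x xA|AB x].
  by have /pi_eq0 := all0 (\pi_(subquot A B)%qT (Sub x xA)); rewrite SubK.
by rewrite -[x]reprK; apply/pi_eq0/AB/valP.
Qed.

(** * Lengths of intervals of ideals, and colengths *)

Section IdealLength.
Variable R : comNzRingType.
Implicit Types (A B C X Y I J K L N G : ideal R) (a b c d x y z : R).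

Lemma ideal0 I : 0 \in I.
Proof. exact: (@rpred0 R^o). Qed.

Lemma ideal_add I x y : x \in I -> y \in I -> x + y \in I.
Proof. exact: (@rpredD R^o). Qed.

Lemma ideal_sub I x y : x \in I -> y \in I -> x - y \in I.
Proof. exact: (@rpredB R^o). Qed.

Lemma ideal_anti I J :
  (forall x, x \in I -> x \in J) -> (forall x, x \in J -> x \in I) -> I = J.
Proof. exact: (@submod_anti R R^o). Qed.

Lemma idealDP I J x :
  reflect (exists y z, [/\ y \in I, z \in J & x = y + z]) (x \in (I + J)%ID).
Proof. exact: asboolP. Qed.

Lemma idealZP c I x :
  reflect (exists2 y, y \in I & x = c * y) (x \in (c *: I)%ID).
Proof. exact: asboolP. Qed.

Lemma in_colon I c x : (x \in (I :/ c)%ID) = (c * x \in I).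
Proof. by []. Qed.

Lemma in_idealI I J x : (x \in (I :&: J)%ID) = (x \in I) && (x \in J).
Proof. by []. Qed.

Lemma ideal_mul I c x : x \in I -> c * x \in I.
Proof. exact: (@rpredZ _ R^o). Qed.

Lemma sub_idealDl I J : {subset I <= (I + J)%ID}.
Proof. by move=> x xI; apply/idealDP; exists x, 0; rewrite addr0 ideal0. Qed.

Lemma sub_idealDr I J : {subset J <= (I + J)%ID}.
Proof. by move=> x xJ; apply/idealDP; exists 0, x; rewrite add0r ideal0. Qed.

Lemma idealD_sub I J K :
  {subset I <= K} -> {subset J <= K} -> {subset (I + J)%ID <= K}.
Proof.
by move=> IK JK _ /idealDP[y [z [/IK yK /JK zK ->]]]; apply: ideal_add.
Qed.

Lemma idealDS I I' J J' : {subset I <= I'} -> {subset J <= J'} ->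
  {subset (I + J)%ID <= (I' + J')%ID}.
Proof.
move=> II JJ; apply: idealD_sub => x => [/II|/JJ].
  exact: sub_idealDl.
exact: sub_idealDr.
Qed.

Lemma idealZS c I J : {subset I <= J} -> {subset (c *: I)%ID <= (c *: J)%ID}.
Proof. by move=> IJ _ /idealZP[y /IJ yJ ->]; apply/idealZP; exists y. Qed.

Lemma mem_idealZ c I x : x \in I -> c * x \in (c *: I)%ID.
Proof. by move=> xI; apply/idealZP; exists x. Qed.

(* By the modular law, each strict step of a chain from A to C stays strict
   after intersecting with B or after adding B. *)
Lemma has_chain_split A B C n : {subset A <= B} -> {subset B <= C} ->
    has_chain (between A C) n ->
  exists p q, [/\ has_chain (between A B) p, has_chain (between B C) q
                & (n <= p + q)%N].
Proof.
move=> AB BC [X [XP Xs]].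
suff: forall i, (i <= n)%N -> exists p q,
    [/\ has_chain (between A (X i :&: B)%ID) p,
        has_chain (between B (X i + B)%ID) q & (i <= p + q)%N].
  move=> /(_ n (leqnn n)) [p [q [Ap Bq npq]]]; exists p, q; split=> //.
    by apply: has_chain_mono Ap => // x; rewrite in_idealI => /andP[].
  by apply: has_chain_mono Bq => //; apply: idealD_sub => //; case: (XP n).
elim=> [_|i IHi lt_in].
  exists 0%N, 0%N; split=> //; apply: has_chain0; last exact: sub_idealDr.
  by move=> x xA; rewrite in_idealI (XP 0%N isT).1 ?AB.
have [p [q [Ap Bq ipq]]] := IHi (ltnW lt_in); have [XX nXX] := Xs i lt_in.
have XXI : {subset (X i :&: B)%ID <= (X i.+1 :&: B)%ID}.
  by move=> x; rewrite !in_idealI => /andP[/XX-> ->].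
have XXD : {subset (X i + B)%ID <= (X i.+1 + B)%ID} by apply: idealDS.
have [eqI|neqI] := EM {subset (X i.+1 :&: B)%ID <= (X i :&: B)%ID}; last first.
  exists p.+1, q; split; last by rewrite addSn.
    by rewrite -(addn1 p); apply: has_chain_cat Ap (has_chain1 XXI neqI).
  exact: has_chain_mono Bq.
have [eqD|neqD] := EM {subset (X i.+1 + B)%ID <= (X i + B)%ID}; last first.
  exists p, q.+1; split; last by rewrite addnS.
    exact: has_chain_mono Ap.
  by rewrite -(addn1 q); apply: has_chain_cat Bq (has_chain1 XXD neqD).
case: nXX => x xX; have /eqD/idealDP[y [z [yX zB def_x]]] := sub_idealDl B xX.
rewrite def_x ideal_add //.
have /eqI : z \in (X i.+1 :&: B)%ID; last by rewrite in_idealI => /andP[].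
by rewrite in_idealI zB andbT -[z](addKr y) -def_x addrC ideal_sub // XX.
Qed.

Definition fin_len A B := exists n, is_len A B n.

(** The default 0 covers intervals without a maximal chain length, so the value is meaningful only
    under [fin_len]. *)
Definition ilen A B : nat := xget 0%N [set n | is_len A B n]%classic.

Lemma ilenP A B : fin_len A B -> is_len A B (ilen A B).
Proof. by case=> n Hn; rewrite /ilen; case: xgetP => // /(_ n). Qed.

Lemma ilen_eq A B n : is_len A B n -> ilen A B = n.
Proof. by move=> Hn; apply: (is_maximum_uniq _ Hn); apply: ilenP; exists n. Qed.

Lemma is_len_add A B C p q : {subset A <= B} -> {subset B <= C} ->
  is_len A B p -> is_len B C q -> is_len A C (p + q).
Proof.
move=> AB BC [Ap maxp] [Bq maxq]; split; first exact: has_chain_cat Bq.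
move=> n /(has_chain_split AB BC)[p' [q' [/maxp lep /maxq leq]]].
by move/leq_trans; apply; apply: leq_add.
Qed.

Lemma fin_len_sub A B A' B' : {subset A <= A'} -> {subset A' <= B'} ->
  {subset B' <= B} -> fin_len A B -> fin_len A' B'.
Proof.
move=> AA AB BB [n [_ maxn]].
apply: (bounded_is_maximum (n0 := 0%N) (b := n)); first exact: has_chain0.
by move=> p /(has_chain_mono AA BB)/maxn.
Qed.

Lemma ilen_add A B C : {subset A <= B} -> {subset B <= C} -> fin_len A C ->
  ilen A C = (ilen A B + ilen B C)%N.
Proof.
move=> AB BC finAC; apply/ilen_eq/(is_len_add AB BC); apply: ilenP.
  exact: fin_len_sub finAC.
exact: fin_len_sub finAC.
Qed.

Lemma ilen_eq0 A B : {subset A <= B} -> fin_len A B ->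
  ilen A B = 0%N <-> {subset B <= A}.
Proof.
move=> AB /ilenP[_ maxAB]; split=> [len0|BA].
  apply: contrapT => nBA; have := maxAB _ (has_chain1 AB nBA).
  by rewrite len0.
apply/ilen_eq; split; first exact: has_chain0.
case=> // n [C [CP /(_ 0%N isT)[_]]]; case.
by move=> x /(CP 1%N isT).2/BA/(CP 0%N isT).1.
Qed.

(** Multiplication by d induces an isomorphism from G modulo [G :&: (L :/ d)] onto (L + dG)/L; on
    submodules it is X -> L + dX, with inverse Y -> [G :&: (Y :/ d)]. *)
Lemma has_chain_mulr L G d n :
  has_chain (between (G :&: (L :/ d))%ID G) n <->
  has_chain (between L (L + d *: G)%ID) n.
Proof.
split.
  apply: (has_chain_map (f := fun X => (L + d *: X)%ID)).
  - move=> X [_ XG]; split; first exact: sub_idealDl.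
    by apply: idealDS => //; apply: idealZS.
  - by move=> X Y _ _ XY; apply: idealDS => //; apply: idealZS.
  - move=> X Y [GX XG] [GY YG] XY x xX.
    have /XY/idealDP[l [_ [lL /idealZP[y yY ->] def_dx]]] :
      d * x \in (L + d *: X)%ID by apply/sub_idealDr/mem_idealZ.
    rewrite -[x](subrK y) ideal_add // GY // in_idealI.
    rewrite (ideal_sub (XG x xX) (YG y yY)).
    by rewrite in_colon mulrBr def_dx addrK.
apply: (has_chain_map (f := fun Y : ideal R => (G :&: (Y :/ d))%ID)).
- move=> Y [LY YL]; split=> x; rewrite !in_idealI => /andP[xG //].
  by rewrite xG; apply: LY.
- by move=> X Y _ _ XY x; rewrite !in_idealI => /andP[-> /XY].
move=> X Y [LX XL] [LY YL] XY x xX.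
have /idealDP[l [_ [lL /idealZP[g gG ->] def_x]]] := XL x xX.
rewrite def_x; apply: ideal_add; first exact: LY.
have : g \in (G :&: (X :/ d))%ID.
  rewrite in_idealI gG in_colon -[d * g](addKr l) -def_x addrC.
  exact: (ideal_sub xX (LX l lL)).
by move/XY; rewrite in_idealI => /andP[].
Qed.

Lemma is_len_mulr L G d n :
  is_len (G :&: (L :/ d))%ID G n <-> is_len L (L + d *: G)%ID n.
Proof.
by split=> -[/has_chain_mulr Ln maxn]; split=> // p /has_chain_mulr /maxn.
Qed.

Definition cofin K := fin_len K (idealT R).
Definition colen K := ilen K (idealT R).

Lemma in_idealT x : x \in idealT R. Proof. by []. Qed.

Lemma cofin_sub K K' : {subset K <= K'} -> cofin K -> cofin K'.
Proof. by move=> KK; apply: fin_len_sub. Qed.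

Lemma modlength_quotm K : cofin K -> modlength (quotm K) = (colen K)%:Z%:E.
Proof.
have qE n := quotm_has_chain K n in_idealT.
move=> /ilenP[Kn maxn]; apply: modlengthE; split=> [|p]; first exact/qE.
by move/qE/maxn.
Qed.

Lemma modlength_quotm_fin K (z : int) : modlength (quotm K) = z%:E ->
  cofin K /\ (colen K)%:Z = z.
Proof.
have qE n := quotm_has_chain K n in_idealT.
move=> /modlength_fin[n -> [/qE Kn maxn]].
have Kl : is_len K (idealT R) n by split=> // p /qE/maxn.
by split; [exists n | rewrite /colen (ilen_eq Kl)].
Qed.

Lemma modlength_subquot A B : {subset B <= A} -> cofin B ->
  modlength (subquot A B) = ((colen B)%:Z - (colen A)%:Z)%:E.
Proof.
move=> BA finB; have subT (K : ideal R) : {subset K <= idealT R} by [].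
rewrite /colen (ilen_add BA (subT A) finB) PoszD addrK.
have /ilenP[Bn maxn] : fin_len B A by apply: fin_len_sub finB.
have sE n := subquot_has_chain n BA.
by apply: modlengthE; split=> [|p]; [exact/sE | move/sE/maxn].
Qed.

Lemma colenS K K' : {subset K <= K'} -> cofin K -> (colen K' <= colen K)%N.
Proof.
by move=> KK finK; rewrite /colen (ilen_add KK _ finK) ?leq_addl.
Qed.

(** The difference of the colengths is the length of K'/K; this turns the vanishing of [M1] into an
    equation between integers. *)
Lemma colen_leq_eq K K' : {subset K <= K'} -> cofin K ->
  colen K = colen K' <-> {subset K' <= K}.
Proof.
move=> KK finK; rewrite /colen (ilen_add KK _ finK) //.
rewrite -(ilen_eq0 KK); last exact: fin_len_sub finK.
by split; lia.
Qed.

Lemma cofin_colon K c : cofin K -> cofin (K :/ c)%ID.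
Proof. by apply: cofin_sub => x xK; rewrite in_colon ideal_mul. Qed.

Lemma idealTI K : (idealT R :&: K)%ID = K.
Proof. by apply: submod_ext => x; rewrite in_idealI. Qed.

Lemma ilen_mulr L G d : cofin L -> cofin G ->
  fin_len L (L + d *: G)%ID /\
  (ilen L (L + d *: G)%ID + colen G = colen (G :&: (L :/ d))%ID)%N.
Proof.
move=> finL finG.
have finGL : fin_len L (L + d *: G)%ID.
  by apply: fin_len_sub finL => //; apply: sub_idealDl.
have GGL : {subset (G :&: (L :/ d))%ID <= G}.
  by move=> x; rewrite in_idealI => /andP[].
have [n Ln] := finGL; have /is_len_mulr GLn := Ln; split=> //.
rewrite (ilen_eq Ln); apply/esym/ilen_eq; apply: is_len_add GLn _ => //.
exact: ilenP.
Qed.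

(** The exact sequence 0 -> R/(K : c) -> R/K -> R/(K + cR) -> 0, whose first map is multiplication
    by c. *)
Lemma colen_mulr K c : cofin K ->
  colen K = (colen (K :/ c)%ID + colen (K + c *: idealT R)%ID)%N.
Proof.
move=> finK; have finT : cofin (idealT R) by apply: cofin_sub finK.
have [_] := ilen_mulr c finK finT; rewrite idealTI => <-.
have T0 : colen (idealT R) = 0%N by apply/ilen_eq0.
by rewrite T0 addn0 /colen; apply: ilen_add => //; apply: sub_idealDl.
Qed.

End IdealLength.

(** * Products and powers of ideals *)

Section IdealMonoid.
Variable R : comNzRingType.
Implicit Types (I J K L N : ideal R) (a b c d u v w x y z : R).

Lemma mem_idealM I J x y : x \in I -> y \in J -> x * y \in (I * J)%ID.
Proof.
move=> xI yJ; apply/asboolP; exists [:: (x, y)]; last by rewrite big_seq1.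
by move=> p; rewrite inE => /eqP->.
Qed.

Lemma idealM_subP I J K :
  {subset (I * J)%ID <= K} <->
  (forall x y, x \in I -> y \in J -> x * y \in K).
Proof.
split=> [IJK x y xI yJ|IJK _ /asboolP[s sP ->]].
  exact/IJK/mem_idealM.
elim: s sP => [_|p s IHs sP]; first by rewrite big_nil ideal0.
rewrite big_cons; apply: ideal_add; last first.
  by apply: IHs => q qs; apply: sP; rewrite inE qs orbT.
by case: (sP p (mem_head p s)) => p1 p2; apply: IJK.
Qed.

Lemma idealMC I J : (I * J = J * I)%ID.
Proof.
by apply: ideal_anti; apply/idealM_subP => x y xI yJ;
  rewrite mulrC mem_idealM.
Qed.

Lemma idealMA I J K : (I * (J * K) = I * J * K)%ID.
Proof.
apply: ideal_anti; apply/idealM_subP => x y.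
  (* For fixed x, membership of [x * y] is membership of y in a colon ideal, so [idealM_subP]
     applies to the second factor as well. *)
  move=> xI; rewrite -in_colon; move: y; apply/idealM_subP => y z yJ zK.
  by rewrite in_colon mulrA !mem_idealM.
move=> + yK; rewrite mulrC -in_colon; move: x; apply/idealM_subP => x z xI zJ.
by rewrite in_colon mulrC -mulrA !mem_idealM.
Qed.

Lemma idealTM I : (idealT R * I = I)%ID.
Proof.
apply: ideal_anti => [|x xI]; last by rewrite -[x]mul1r mem_idealM.
by apply/idealM_subP => x y _; apply: ideal_mul.
Qed.

Lemma idealMCA I J K : (I * (J * K) = J * (I * K))%ID.
Proof. by rewrite idealMA [(I * J)%ID]idealMC -idealMA. Qed.

Lemma idealXS I n : (I ^+ n.+1 = I * I ^+ n)%ID. Proof. by []. Qed.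

Lemma idealXM I J n : ((I * J) ^+ n = I ^+ n * J ^+ n)%ID.
Proof.
elim: n => [|n IHn]; first by rewrite idealTM.
by rewrite !idealXS IHn -!idealMA (idealMCA J).
Qed.

Lemma idealMS I I' J J' : {subset I <= I'} -> {subset J <= J'} ->
  {subset (I * J)%ID <= (I' * J')%ID}.
Proof.
by move=> II JJ; apply/idealM_subP => x y /II xI /JJ yJ; apply: mem_idealM.
Qed.

Lemma idealX_anti I p n : (p <= n)%N -> {subset (I ^+ n)%ID <= (I ^+ p)%ID}.
Proof.
move/subnK <-; elim: (n - p)%N => // k IHk x.
by rewrite addSn idealXS => /(idealM_subP _ _ _).2; apply=> y z _ /IHk/ideal_mul.
Qed.

Lemma mem_idealX I x n : x \in I -> x ^+ n \in (I ^+ n)%ID.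
Proof.
by move=> xI; elim: n => [|n IHn]; rewrite ?exprS ?idealXS ?mem_idealM.
Qed.

Lemma mem_idealXl I J r k s x y :
  x \in I -> y \in (I ^+ r * J ^+ s)%ID ->
  x ^+ k * y \in (I ^+ (r + k) * J ^+ s)%ID.
Proof.
move=> xI yIJ; elim: k => [|k IHk]; first by rewrite mul1r addn0.
by rewrite exprS -mulrA addnS idealXS -idealMA mem_idealM.
Qed.

Lemma mem_idealXr I J r k s x y :
  x \in J -> y \in (I ^+ r * J ^+ s)%ID ->
  x ^+ k * y \in (I ^+ r * J ^+ (s + k))%ID.
Proof. by rewrite !(idealMC (I ^+ r)); apply: mem_idealXl. Qed.

(** * Pairs with vanishing first Koszul homology, and colengths *)

Definition ideal2 c d : ideal R := (c *: idealT R + d *: idealT R)%ID.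

Lemma ideal2P c d x :
  reflect (exists u v, x = c * u + d * v) (x \in ideal2 c d).
Proof.
apply: (iffP (idealDP _ _ _)).
  by case=> _ [_ [/idealZP[u _ ->] /idealZP[v _ ->] ->]]; exists u, v.
by case=> u [v ->]; exists (c * u), (d * v); split=> //; apply: mem_idealZ.
Qed.

(* The first Koszul homology of (c, d) vanishes. *)
Definition koszul_exact c d :=
  forall u v, c * u = d * v -> exists w, u = d * w /\ v = c * w.

Lemma koszul_exactC c d : koszul_exact c d -> koszul_exact d c.
Proof.
by move=> cd u v /esym/cd[w [-> ->]]; exists w.
Qed.

Lemma koszul_exactM c c' d :
  koszul_exact c d -> koszul_exact c' d -> koszul_exact (c * c') d.
Proof.
move=> cd c'd u v; rewrite -mulrA => /cd[w [/c'd[z [-> ->]] ->]].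
by exists z; rewrite mulrA.
Qed.

Lemma koszul_exact1 d : koszul_exact 1 d.
Proof. by move=> u v; rewrite mul1r => ->; exists v; rewrite mul1r. Qed.

Lemma koszul_exactX c d i j :
  koszul_exact c d -> koszul_exact (c ^+ i) (d ^+ j).
Proof.
have expl e f n : koszul_exact e f -> koszul_exact (e ^+ n) f.
  move=> ef; elim: n => [|n IHn]; first exact: koszul_exact1.
  by rewrite exprS; apply: koszul_exactM.
by move=> cd; apply/expl/koszul_exactC/expl/koszul_exactC.
Qed.

(* [x] and [y] act on the Koszul homology of (c, d) by zero, so a syzygy (u, v)
   becomes a trivial one after multiplication by [x] or by [y]; regularity of
   x, y descends this to (u, v) itself. *)
Lemma regular_koszul_exact c d x y :
    (forall z, x * z = 0 -> z = 0) -> koszul_exact x y ->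
    x \in ideal2 c d -> y \in ideal2 c d ->
  koszul_exact c d.
Proof.
move=> xreg xy /ideal2P[p [q def_x]] /ideal2P[p' [q' def_y]] u v cu_dv.
have triv s t : (c * s + d * t) * u = d * (s * v + t * u) /\
                (c * s + d * t) * v = c * (s * v + t * u).
  split; first by rewrite mulrDl mulrAC cu_dv; ring.
  by rewrite mulrDl [d * t * v]mulrAC -cu_dv; ring.
have [xu xv] := triv p q; have [yu yv] := triv p' q'.
rewrite -def_x in xu xv; rewrite -def_y in yu yv.
move: (p * v + _) (p' * v + _) => wx wy in xu xv yu yv *.
(* Both c and d annihilate the difference of the two sides, hence so does x, which lies in (c, d)
   and is regular. *)
have eqw : x * wy = y * wx.
  have cw0 : c * (x * wy - y * wx) = 0.
    by rewrite mulrBr (mulrCA c y) (mulrCA c x) -xv -yv; ring.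
  have dw0 : d * (x * wy - y * wx) = 0.
    by rewrite mulrBr (mulrCA d y) (mulrCA d x) -xu -yu; ring.
  apply/eqP; rewrite -subr_eq0; apply/eqP/xreg.
  by rewrite {1}def_x mulrDl mulrAC cw0 [d * q * _]mulrAC dw0 !mul0r addr0.
(* Here [wx = x * t]; cancelling x in [x * u = d * wx] and [x * v = c * wx] shows that t is the
   witness. *)
have [t [_ def_wx]] := xy _ _ eqw; exists t.
by split; apply/eqP; rewrite -subr_eq0; apply/eqP/xreg;
  rewrite mulrBr ?xu ?xv def_wx; ring.
Qed.

(** If d x = c u + d n, exactness applied to c u = d (x - n) makes x - n a multiple of c. *)
Lemma koszul_colonl c d N : koszul_exact c d ->
  ((c *: idealT R + d *: N) :/ d)%ID = (N + c *: idealT R)%ID.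
Proof.
move=> cd; apply: ideal_anti => x; rewrite in_colon => /idealDP.
  case=> _ [_ [/idealZP[u _ ->] /idealZP[n nN ->] dx]].
  have /cd[w [_ xn]] : c * u = d * (x - n) by rewrite mulrBr dx addrK.
  by apply/idealDP; exists n, (c * w); rewrite mem_idealZ // -xn addrC subrK.
case=> n [_ [nN /idealZP[u _ ->] ->]]; apply/idealDP.
by exists (c * (d * u)), (d * n); split; rewrite ?mem_idealZ //; ring.
Qed.

(** If c x = d n + c l, exactness gives x - l = d w and n = c w, so w lies in N : c. *)
Lemma koszul_colonr c d L N : koszul_exact c d ->
  ((d *: N + c *: L) :/ c)%ID = (L + d *: (N :/ c))%ID.
Proof.
move=> cd; apply: ideal_anti => x; rewrite in_colon => /idealDP.
  case=> _ [_ [/idealZP[n nN ->] /idealZP[l lL ->] cx]].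
  have /cd[w [xl nw]] : c * (x - l) = d * n by rewrite mulrBr cx addrK.
  apply/idealDP; exists l, (d * w); rewrite mem_idealZ ?in_colon -?nw //.
  by rewrite -xl addrC subrK.
case=> l [_ [lL /idealZP[u uN ->] ->]]; apply/idealDP.
by exists (d * (c * u)), (c * l); split; rewrite ?mem_idealZ //; ring.
Qed.

Lemma idealDC I J : (I + J = J + I)%ID.
Proof.
by apply: ideal_anti; apply: idealD_sub;
  (exact: sub_idealDr || exact: sub_idealDl).
Qed.

Lemma subT I : {subset I <= idealT R}. Proof. by []. Qed.

(* Filter (c, d) by (c, d N) and (c L, d N); the quotients of this filtration
   are cyclic up to colon ideals, computed by koszul_colonl and
   koszul_colonr. *)
Lemma colen_koszul c d L N :
    koszul_exact c d -> cofin (ideal2 c d) -> cofin L -> cofin N ->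
  cofin (c *: L + d *: N)%ID /\
  (colen (c *: L + d *: N) + colen ((L :/ d) :&: (N :/ c)) =
   colen (ideal2 c d) + colen L + colen N)%N.
Proof.
move=> cd fin2 finL finN; have finT : cofin (idealT R) by apply: cofin_sub finL.
have finNc := cofin_colon c finN.
have T0 : colen (idealT R) = 0%N by apply/ilen_eq0.
set A := (c *: L + d *: N)%ID; set B := (c *: idealT R + d *: N)%ID.
have AB : {subset A <= B} by apply: idealDS => //; apply: idealZS.
have BC : {subset B <= ideal2 c d} by apply: idealDS => //; apply: idealZS.
have defB : (A + c *: idealT R)%ID = B.
  apply: ideal_anti; first by apply: idealD_sub => //; apply: sub_idealDl.
  apply: idealD_sub; first exact: sub_idealDr.
  by move=> x xN; apply/sub_idealDl/sub_idealDr.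
have defC : (B + d *: idealT R)%ID = ideal2 c d.
  apply: ideal_anti; first by apply: idealD_sub => //; apply: sub_idealDr.
  by apply: idealDS => //; apply: sub_idealDl.
have defBd : (idealT R :&: (B :/ d))%ID = (N + c *: idealT R)%ID.
  by rewrite idealTI koszul_colonl.
have defAc : (idealT R :&: (A :/ c))%ID = (L + d *: (N :/ c))%ID.
  by rewrite idealTI /A idealDC koszul_colonr.
have finNcT : cofin (N + c *: idealT R)%ID.
  by apply: cofin_sub finN; apply: sub_idealDl.
have finLdN : cofin (L + d *: (N :/ c))%ID.
  by apply: cofin_sub finL; apply: sub_idealDl.
have BCn : is_len B (ideal2 c d) (colen (N + c *: idealT R)%ID).
  by rewrite -defC; apply/is_len_mulr; rewrite defBd; apply: ilenP.
have ABn : is_len A B (colen (L + d *: (N :/ c))%ID).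
  by rewrite -{1}defB; apply/is_len_mulr; rewrite defAc; apply: ilenP.
have CTn := ilenP fin2.
have BTn := is_len_add BC (@subT _) BCn CTn.
have ATn := is_len_add AB (@subT _) ABn BTn.
split; first by eexists; exact: ATn.
rewrite [colen A](ilen_eq ATn) -/(colen _).
(* The lengths of (L + d(N : c))/L and R/(N : c) add up to the colength of the intersection, the
   only correction term left. *)
have [_ LdN] := ilen_mulr d finL finNc.
have LdN' : colen L = (ilen L (L + d *: (N :/ c))%ID
                       + colen (L + d *: (N :/ c))%ID)%N.
  by apply: ilen_add => //; apply: sub_idealDl.
have := colen_mulr c finN; rewrite LdN'.
have -> : (((L :/ d) :&: (N :/ c)) = ((N :/ c) :&: (L :/ d)))%ID.
  by apply: ideal_anti => x; rewrite !in_idealI => /andP[-> ->].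
by rewrite -LdN; lia.
Qed.

(** Brings powers into the shape cL + dN of [colen_koszul], for induction on i. *)
Lemma ideal2_expS c d i j :
  ideal2 (c ^+ i.+1) (d ^+ j) =
  (c ^+ i *: ideal2 c (d ^+ j) + d ^+ j *: idealT R)%ID.
Proof.
apply: ideal_anti => x.
  case/ideal2P=> u [v ->]; apply/idealDP; exists (c ^+ i * (c * u)), (d ^+ j * v).
  rewrite !mem_idealZ //; first by rewrite exprSr !mulrA.
  by apply/ideal2P; exists u, 0; rewrite mulr0 addr0.
case/idealDP=> _ [_ [/idealZP[_ /ideal2P[u [v ->]] ->] /idealZP[w _ ->] ->]].
by apply/ideal2P; exists u, (c ^+ i * v + w); rewrite exprSr; ring.
Qed.

Lemma ideal2C c d : ideal2 c d = ideal2 d c.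
Proof. exact: idealDC. Qed.

Lemma ideal21 c : ideal2 1 c = idealT R.
Proof.
apply: ideal_anti => // x _; apply/ideal2P; exists x, 0.
by rewrite mul1r mulr0 addr0.
Qed.

Lemma colen_ideal2X c d i j : koszul_exact c d -> cofin (ideal2 c d) ->
  cofin (ideal2 (c ^+ i) (d ^+ j)) /\
  colen (ideal2 (c ^+ i) (d ^+ j)) = (i * j * colen (ideal2 c d))%N.
Proof.
have expl e f n : koszul_exact e f -> cofin (ideal2 e f) ->
    cofin (ideal2 (e ^+ n) f) /\
    colen (ideal2 (e ^+ n) f) = (n * colen (ideal2 e f))%N.
  move=> ef fin_ef; have finT : cofin (idealT R) by apply: cofin_sub fin_ef.
  have T0 : colen (idealT R) = 0%N by apply/ilen_eq0.
  elim: n => [|n [IHfin IHn]]; first by rewrite ideal21 T0.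
  rewrite -[f]expr1 ideal2_expS expr1.
  (* Both colon ideals are R here, so one more factor e adds exactly the colength of (e, f). *)
  have [] // := @colen_koszul (e ^+ n) f (ideal2 e f) (idealT R).
  - by rewrite -[f]expr1; apply: koszul_exactX.
  - move=> fin_n; rewrite IHn T0.
    have -> : ((ideal2 e f :/ f) :&: (idealT R :/ e ^+ n))%ID = idealT R.
      apply: ideal_anti => // x _; rewrite in_idealI !in_colon andbT.
      by apply/ideal2P; exists 0, x; rewrite mulr0 add0r.
    by rewrite T0 mulSn; split=> //; lia.
move=> cd fin_cd; have dc := koszul_exactC cd.
have [|fin_j len_j] := expl d c j dc; first by rewrite ideal2C.
have cdj : koszul_exact c (d ^+ j).
  by have := koszul_exactX (i := 1) (j := j) cd; rewrite expr1.
rewrite ideal2C in fin_j; have [fin_ij ->] := expl c (d ^+ j) i cdj fin_j.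
by split; rewrite // (ideal2C c (d ^+ j)) len_j ideal2C mulnA.
Qed.

End IdealMonoid.

(** * Regular sequences, joint reductions and the stable value of [Ftilde_at] *)

Section RegularSequences.
Variable R : comNzRingType.
Implicit Types (I J K m : ideal R) (a b x y z : R).

(** The depth is the dimension, two. If x u = y v, regularity of y modulo x gives v = x w, and
    cancelling x gives u = y w. *)
Lemma depth2_regular m : cohen_macaulay m -> krull_dim R 2 ->
  exists x y, [/\ x \in m, y \in m, forall z, x * z = 0 -> z = 0
                & koszul_exact x y].
Proof.
move=> [d dimd [[s [def_d sm [_ reg_s]]] _]] dim2.
move: def_d; rewrite (is_maximum_uniq dimd dim2).
case: s sm reg_s => [|x [|y [|]]] //= sm reg_s _.
have xreg z : x * z = 0 -> z = 0.
  move=> xz0; have /asboolP[c ->] : z \in ideal_gen [::]; last exact: big_ord0.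
  by apply: (reg_s 0%N z isT); rewrite /= xz0; exact: (ideal0 (ideal_gen [::])).
exists x, y; split=> //; rewrite ?sm ?inE ?eqxx ?orbT // => u v xu_yv.
have /asboolP[c] : v \in ideal_gen [:: x].
  apply: (reg_s 1%N v isT); rewrite /= -xu_yv; apply/asboolP.
  by exists (fun=> u); rewrite big_ord1 mulrC.
rewrite big_ord1 /= mulrC => def_v; exists (c 0%N); split=> //.
apply/eqP; rewrite -subr_eq0; apply/eqP/xreg.
by rewrite mulrBr xu_yv def_v; ring.
Qed.

(** One instance of the defining equation; it gives R/(a, b) finite length and puts powers of
    elements of m into (a, b). *)
Lemma joint_reduction_sub I J a b : joint_reduction I J a b ->
  exists N, {subset (I ^+ N * J ^+ N)%ID <= ideal2 a b}.
Proof.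
case=> _ _ [N redN]; exists N.+1 => x; rewrite redN //.
by apply: idealDS; apply: idealZS.
Qed.

Lemma joint_reduction_power m I J a b x : joint_reduction I J a b ->
  primary_to m I -> primary_to m J -> x \in m ->
  exists n, x ^+ n \in ideal2 a b.
Proof.
move=> /joint_reduction_sub[N subN] [_ radI] [_ radJ] xm.
have [[n xnI] [p xpJ]] := ((radI x).1 xm, (radJ x).1 xm).
(* The first summand puts the power into I^N, the second into J^N. *)
exists (n * N + p * N)%N; apply: subN.
by rewrite exprD !exprM; apply: mem_idealM; apply: mem_idealX.
Qed.

Lemma nonzero_divisorX x n :
  (forall z, x * z = 0 -> z = 0) -> forall z, x ^+ n * z = 0 -> z = 0.
Proof.
move=> xreg z; elim: n => [|n IHn]; first by rewrite mul1r.
by rewrite exprS -mulrA => /xreg.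
Qed.

Lemma joint_reduction_koszul m I J a b : cohen_macaulay m -> krull_dim R 2 ->
    primary_to m I -> primary_to m J -> joint_reduction I J a b ->
  koszul_exact a b.
Proof.
move=> CM dim2 mI mJ abred.
have [x [y [xm ym xreg xy]]] := depth2_regular CM dim2.
have [n xn] := joint_reduction_power abred mI mJ xm.
have [p yp] := joint_reduction_power abred mI mJ ym.
apply: regular_koszul_exact xn yp; last exact: koszul_exactX.
exact: nonzero_divisorX.
Qed.

(** The union of the increasing family is finitely generated, so one member contains all
    generators. *)
Lemma Ftilde_stable I J a b (abred : joint_reduction I J a b) r s :
  noetherian R -> exists N, forall k, (N <= k)%N ->
    Ftilde_at I J a b r s k = Ftilde abred r s.
Proof.
move=> noethR; have [t Ft] := noethR (Ftilde abred r s).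
suff [N subN] : exists N, {subset t <= Ftilde_at I J a b r s N}.
  (* The successor ensures the condition [1 <= k] of [Ftilde_pred]. *)
  exists N.+1 => k ltNk; apply: ideal_anti => x xF.
    by apply/asboolP; exists k => //; apply: leq_trans ltNk.
  apply: (Ftilde_at_sub abred (ltnW ltNk)).
  have : x \in ideal_gen t by rewrite -Ft.
  case/asboolP=> c ->; apply: (big_ind (fun y => y \in _)).
  - exact: ideal0.
  - exact: ideal_add.
  - by move=> i _; apply/ideal_mul/subN/mem_nth.
have : {subset t <= Ftilde abred r s}.
  move=> x xt; rewrite Ft; apply/asboolP.
  (* A Kronecker delta at the first occurrence of x in t. *)
  exists (fun i => (i == index x t)%:R).
  rewrite -index_mem in xt; rewrite (bigD1 (Ordinal xt)) //= eqxx mul1r.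
  rewrite nth_index -?index_mem // big1 ?addr0 // => i /negPf.
  by rewrite -val_eqE /= => ->; rewrite mul0r.
elim: t {Ft} => [|x t IHt] tF; first by exists 0%N.
have [|N subN] := IHt; first by move=> y yt; apply: tF; rewrite inE yt orbT.
have /asboolP[k _ xk] := tF x (mem_head x t).
exists (maxn k N) => y; rewrite inE => /orP[/eqP->|/subN].
  by apply: Ftilde_at_sub xk; rewrite ?leq_maxl.
by apply: Ftilde_at_sub; rewrite ?leq_maxr.
Qed.

End RegularSequences.

(** * The length of [M1] and the growth of colengths *)

Section Growth.
Variable R : comNzRingType.
Implicit Types (I J : ideal R) (a b : R).

(** An instance of [colen_koszul] for (a^k, b^k), whose intersection of colon ideals is
    [Ftilde_at]. *)
Lemma colen_M1 I J a b r s k : koszul_exact a b -> cofin (ideal2 a b) ->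
    (forall p q, cofin (I ^+ p * J ^+ q)%ID) ->
  let den := (a ^+ k *: (I ^+ r * J ^+ (s + k)) +
              b ^+ k *: (I ^+ (r + k) * J ^+ s))%ID in
  cofin den /\
  (colen den + colen (Ftilde_at I J a b r s k) = k * k * colen (ideal2 a b) +
   colen (I ^+ r * J ^+ (s + k)) + colen (I ^+ (r + k) * J ^+ s))%N.
Proof.
move=> ab fin_ab finIJ den; have [fin_k len_k] := colen_ideal2X k k ab fin_ab.
have [|fin_den] := @colen_koszul _ (a ^+ k) (b ^+ k) _ _ _ fin_k
  (finIJ r (s + k)%N) (finIJ (r + k)%N s); first exact: koszul_exactX.
rewrite len_k => <-; split=> //; congr (_ + colen _)%N.
by apply: ideal_anti => x; rewrite !in_idealI => /andP[-> ->].
Qed.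

Lemma M1_den_sub I J a b r s k : a \in I -> b \in J ->
  {subset (a ^+ k *: (I ^+ r * J ^+ (s + k)) +
           b ^+ k *: (I ^+ (r + k) * J ^+ s))%ID
    <= (I ^+ (r + k) * J ^+ (s + k))%ID}.
Proof.
move=> aI bJ; apply: idealD_sub => _ /idealZP[x xIJ ->].
  exact: mem_idealXl.
exact: mem_idealXr.
Qed.

Lemma sub_Ftilde_at I J a b r s k : a \in I -> b \in J ->
  {subset (I ^+ r * J ^+ s)%ID <= Ftilde_at I J a b r s k}.
Proof.
move=> aI bJ x xIJ; rewrite inE; apply/andP.
by split; [apply: mem_idealXl | apply: mem_idealXr].
Qed.

(* [a ^+ k] embeds R / (I^(r+k) J^s : a^k), a quotient of R / I^r J^s, into
   R / I^(r+k) J^s; modulo [a ^+ k], passing from s to s + 1 adds at most the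
   length of R / (a^k, b), since b I^(r+k) J^s lies in I^(r+k) J^(s+1). *)
Lemma colen_growth I J a b r k s : koszul_exact a b -> cofin (ideal2 a b) ->
    (forall p q, cofin (I ^+ p * J ^+ q)%ID) -> a \in I -> b \in J ->
  (colen (I ^+ (r + k) * J ^+ s) <= colen (I ^+ r * J ^+ s) +
     k * colen (ideal2 a b) * s +
     colen (I ^+ (r + k) * J ^+ 0 + a ^+ k *: idealT R))%N.
Proof.
move=> ab fin_ab finIJ aI bJ; rewrite (colen_mulr (a ^+ k)) // -addnA.
apply: leq_add.
  by apply: colenS => // x; apply: mem_idealXl.
elim: s => [|s IHs]; first by rewrite muln0.
have [] := colen_ideal2X k 1 ab fin_ab; rewrite expr1 muln1 => fin_k len_k.
have akb : koszul_exact (a ^+ k) b.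
  by have := koszul_exactX (i := k) (j := 1) ab; rewrite expr1.
have finN := finIJ (r + k)%N s; set N := (_ * _ ^+ s)%ID in finN IHs.
have finT : cofin (idealT R) by apply: cofin_sub finN.
have T0 : colen (idealT R) = 0%N by apply/ilen_eq0.
(* With L = R, the colength of (a^k) + bN exceeds that of N + (a^k) by k times that of (a, b). *)
have [fin_den] := colen_koszul akb fin_k finT finN.
have -> : (idealT R :/ b)%ID = idealT R by apply: ideal_anti.
rewrite idealTI len_k T0 addn0 (colen_mulr (a ^+ k) finN) => len_den.
have := @colenS _ _ (I ^+ (r + k) * J ^+ s.+1 + a ^+ k *: idealT R)%ID _ fin_den.
have subX : {subset (a ^+ k *: idealT R + b *: N)%ID <=
    (I ^+ (r + k) * J ^+ s.+1 + a ^+ k *: idealT R)%ID}.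
  apply: idealD_sub; first exact: sub_idealDr.
  move=> _ /idealZP[x xN ->]; apply: sub_idealDl.
  by have := mem_idealXr 1 bJ xN; rewrite expr1 addn1.
by move=> /(_ subX); lia.
Qed.

End Growth.

(** * Comparison of coefficients of integer polynomials *)

Section IntegerPolynomials.
Implicit Types (p q t : int) (N n : nat).

Lemma bin2S n : 'C(n.+2, 2)%:Z = 'C(n.+1, 2)%:Z + n.+1%:Z.
Proof. by rewrite binS bin1 PoszD. Qed.

(** Three consecutive values suffice: p is the second difference, and then q is the first. *)
Lemma bin2_poly_eq0 N p q t :
    (forall n, (N <= n)%N -> p * 'C(n.+1, 2)%:Z + q * n%:Z + t = 0) ->
  [/\ p = 0, q = 0 & t = 0].
Proof.
move=> poly0; have P0 := poly0 N (leqnn N).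
have := poly0 N.+1 (leqnSn N).
have := poly0 N.+2 (leq_trans (leqnSn N) (leqnSn _)).
rewrite !bin2S; move: 'C(_, _) P0 => B P0 P2 P1.
have p0 : p = 0 by lia.
have q0 : q = 0 by move: P0 P1; rewrite p0; lia.
by split=> //; move: P0; rewrite p0 q0; lia.
Qed.

Lemma linear_bounded_le0 N q t :
  (forall n, (N <= n)%N -> q * n%:Z <= t) -> q <= 0.
Proof.
(* A positive q would give q n >= n > t at this n. *)
move=> bound; have := bound (N + `|t| + 1)%N; rewrite -addnA leq_addr => /(_ isT).
by nia.
Qed.

End IntegerPolynomials.

Section IntegerNumerics.
Variables (H : nat -> nat -> int) (e11 e20 e02 e10 e01 e00 eJ0 lam : int).
Variables (g1 g2 : nat -> int) (N : nat).

(** Compares coefficients of polynomials in s along fixed rows r. The function [H] is abstract so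
    that its transpose is covered too. *)
Lemma growth_slope :
    (forall r s, (N <= r)%N -> (N <= s)%N -> H r s =
       e11 * r%:Z * s%:Z + e20 * 'C(r.+1, 2)%:Z + e02 * 'C(s.+1, 2)%:Z
       - e10 * r%:Z - e01 * s%:Z + e00) ->
    (forall r, exists M, forall s, (M <= s)%N ->
       H r s = eJ0 * 'C(s.+1, 2)%:Z - g1 r * s%:Z + g2 r) ->
    (forall r k, exists C : int, forall s,
       H (r + k)%N s <= H r s + k%:Z * lam * s%:Z + C) ->
  [/\ e02 = eJ0, e11 <= lam &
      lam = e11 -> forall r, 0 <= e01 - (g1 r + r%:Z * e11)].
Proof.
move=> HP gP growth.
have e02E : e02 = eJ0.
  have [M gN] := gP N.
  have := @bin2_poly_eq0 (N + M) (e02 - eJ0) (e11 * N%:Z - e01 + g1 N)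
    (e20 * 'C(N.+1, 2)%:Z - e10 * N%:Z + e00 - g2 N).
  case=> [s les|/eqP + _ _]; last by rewrite subr_eq0 => /eqP.
  have := HP N s (leqnn N) ltac:(lia); rewrite gN; last by lia.
  by move: 'C(_, _) 'C(_, _) => B B'; lia.
split=> //.
  have [C grN] := growth N 1%N; rewrite -subr_le0.
  apply: (@linear_bounded_le0 N _ (C - e20 * N.+1%:Z + e10)) => s les.
  have := grN s; rewrite addn1 !HP ?leqW // bin2S.
  by move: 'C(_, _) 'C(_, _) => B B'; lia.
(* Taking k = N brings row r + N into the range of the bigraded polynomial. *)
move=> lamE r; have [C grN] := growth r N; have [M gr] := gP r.
suff: e11 * (r + N)%:Z - e01 + g1 r - N%:Z * lam <= 0 by rewrite lamE; lia.
apply: (@linear_bounded_le0 (N + M) _ (C + g2 r - e20 * 'C((r + N).+1, 2)%:Z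
  + e10 * (r + N)%:Z - e00)) => s les.
have := grN s; rewrite gr; last by lia.
rewrite HP; [|lia..]; rewrite e02E.
by move: 'C(_, _) 'C(_, _) => B B'; lia.
Qed.

End IntegerNumerics.

(** * The equivalence of the three conditions at (r0, s0) *)

Theorem theorem3p30 (R : comNzRingType) (m I J : ideal R) (a b : R)
    (r0 s0 : nat)
    (eI eJ eIJ : nat -> int) (e : nat -> nat -> int)
    (g1 g2 h1 h2 : nat -> int)
    (R_noetherian : noetherian R)
    (R_local : is_local m)
    (R_CM : cohen_macaulay m)
    (R_dim2 : krull_dim R 2)
    (residue_infinite : infinite_set [set: quotm m])
    (I_primary : primary_to m I)
    (J_primary : primary_to m J)
    (ab_red : joint_reduction I J a b)
    (eIP : hilbert_coeffs I eI)
    (eJP : hilbert_coeffs J eJ)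
    (eIJP : hilbert_coeffs (I * J) eIJ)
    (eP : bigraded_hilbert_coeffs I J e)
    (gP : forall r : nat, exists N : nat, forall s : nat, (N <= s)%N ->
      modlength (quotm (I ^+ r * J ^+ s)%ID) =
      (eJ 0%N * 'C(s.+1, 2)%:Z - g1 r * s%:Z + g2 r)%:E)
    (hP : forall s : nat, exists N : nat, forall r : nat, (N <= r)%N ->
      modlength (quotm (I ^+ r * J ^+ s)%ID) =
      (eI 0%N * 'C(r.+1, 2)%:Z - h1 s * r%:Z + h2 s)%:E) :
  [<->
    (* a *)
    exists N : nat, forall k : nat, (N <= k)%N ->
      (I ^+ (r0 + k) * J ^+ (s0 + k) =i
       a ^+ k *: (I ^+ r0 * J ^+ (s0 + k))
       + b ^+ k *: (I ^+ (r0 + k) * J ^+ s0))%ID;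
    (* b *)
    [/\ e 0%N 1%N = g1 r0 + r0%:Z * e 1%N 1%N,
        e 1%N 0%N = h1 s0 + s0%:Z * e 1%N 1%N &
        (eIJ 2%N)%:E =
        ((g2 r0 + h2 s0)%:E
         - modlength (quotm (I ^+ r0 * J ^+ s0)%ID)
         + (r0%:Z * s0%:Z * e 1%N 1%N)%:E
         + modlength (subquot (Ftilde ab_red r0 s0)
                              (I ^+ r0 * J ^+ s0)%ID))%E];
    (* c *)
    exists N : nat, forall k : nat, (N <= k)%N ->
      forall x : M1 I J a b r0 s0 k, x = 0 ].
Proof.
(* By [gP] the length is an integer, hence finite, for large s; smaller exponents give larger
   ideals. *)
have finIJ r s : cofin (I ^+ r * J ^+ s)%ID.
  have [N /(_ _ (leq_maxl N s)) /modlength_quotm_fin[fin_rs _]] := gP r.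
  by apply: cofin_sub fin_rs; apply: idealMS => //; apply/idealX_anti/leq_maxr.
pose H r s : int := (colen (I ^+ r * J ^+ s)%ID)%:Z.
have lenH r s z : modlength (quotm (I ^+ r * J ^+ s)%ID) = z%:E -> H r s = z.
  by move/modlength_quotm_fin=> [].
have aI := joint_reductionl ab_red; have bJ := joint_reductionr ab_red.
have ab := joint_reduction_koszul R_CM R_dim2 I_primary J_primary ab_red.
have fin_ab : cofin (ideal2 a b).
  by have [N subN] := joint_reduction_sub ab_red; apply: cofin_sub (finIJ N N).
pose lam : int := (colen (ideal2 a b))%:Z.
have [N1 eH] := eP.
have {eH} HP r s : (N1 <= r)%N -> (N1 <= s)%N -> H r s =
    e 1%N 1%N * r%:Z * s%:Z + e 2%N 0%N * 'C(r.+1, 2)%:Z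
    + e 0%N 2%N * 'C(s.+1, 2)%:Z - e 1%N 0%N * r%:Z - e 0%N 1%N * s%:Z
    + e 0%N 0%N.
  move=> ler les; rewrite (lenH _ _ _ (eH r s ler les)).
  under eq_bigr do rewrite big_mkcond !big_ord_recr big_ord0 /=.
  rewrite !big_ord_recr big_ord0 /= !addn0 !addn1 !addn2 /= !bin0 !bin1.
  ring.
have gH r : exists M, forall s, (M <= s)%N ->
    H r s = eJ 0%N * 'C(s.+1, 2)%:Z - g1 r * s%:Z + g2 r.
  by have [M gM] := gP r; exists M => s /gM/lenH.
have hH s : exists M, forall r, (M <= r)%N ->
    H r s = eI 0%N * 'C(r.+1, 2)%:Z - h1 s * r%:Z + h2 s.
  by have [M hM] := hP s; exists M => r /hM/lenH.
have growthI r k : exists C : int, forall s,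
    H (r + k)%N s <= H r s + k%:Z * lam * s%:Z + C.
  exists (colen (I ^+ (r + k) * J ^+ 0 + a ^+ k *: idealT R)%ID)%:Z => s.
  by have := colen_growth r k s ab fin_ab finIJ aI bJ; rewrite /H /lam; lia.
have growthJ s k : exists C : int, forall r,
    H r (s + k)%N <= H r s + k%:Z * lam * r%:Z + C.
  exists (colen (J ^+ (s + k) * I ^+ 0 + b ^+ k *: idealT R)%ID)%:Z => r.
  have finJI p q : cofin (J ^+ p * I ^+ q)%ID by rewrite idealMC.
  have fin_ba : cofin (ideal2 b a) by rewrite ideal2C.
  have := colen_growth s k r (koszul_exactC ab) fin_ba finJI bJ aI.
  by rewrite ideal2C !(idealMC (J ^+ _) (I ^+ r)) /H /lam; lia.
have [e02E e11_le A_ge0] := growth_slope HP gH growthI.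
(* The bigraded polynomial with its variables exchanged, for the transpose of [H]. *)
have HPC s r : (N1 <= s)%N -> (N1 <= r)%N -> H r s =
    e 1%N 1%N * s%:Z * r%:Z + e 0%N 2%N * 'C(s.+1, 2)%:Z
    + e 2%N 0%N * 'C(r.+1, 2)%:Z - e 0%N 1%N * s%:Z - e 1%N 0%N * r%:Z
    + e 0%N 0%N by move=> les ler; rewrite HP //; ring.
have [e20E _ B_ge0] := @growth_slope (fun s r => H r s) _ _ _ _ _ _ _ _ _ _ _
  HPC hH growthJ.
have lamE : lam = e 1%N 1%N.
  apply/eqP; rewrite eq_le e11_le andbT.
  (* For k = 1 and r = s large, [M1] vanishes and [Ftilde_at] contains I^r J^r, so lam is at most
     the mixed second difference of [H], which is e_(1,1). *)
  have [_ _ [N2 red2]] := ab_red; pose r := (N1 + N2)%N.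
  have [fin_den] := colen_M1 r r 1 ab fin_ab finIJ.
  have Fle := @colenS _ _ _ (@sub_Ftilde_at _ I J a b r r 1 aI bJ) (finIJ r r).
  rewrite !expr1 !addn1.
  have <- := submod_ext (red2 r r (leq_addl _ _) (leq_addl _ _)).
  move=> eq1; have : lam + H r r.+1 + H r.+1 r <= H r.+1 r.+1 + H r r.
    by rewrite /lam /H; lia.
  rewrite !HP ?leqW ?leq_addr // !bin2S.
  by move: 'C(_, _) => B; lia.
(* On the diagonal both Hilbert polynomials give the length of R/(IJ)^n; compare constant terms. *)
have e00E : e 0%N 0%N = eIJ 2%N.
  have [N2 eIJH] := eIJP.
  have := @bin2_poly_eq0 (N1 + N2)
    (e 2%N 0%N + e 0%N 2%N + 2 * e 1%N 1%N - eIJ 0%N)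
    (eIJ 1%N - e 1%N 0%N - e 0%N 1%N - e 1%N 1%N) (e 0%N 0%N - eIJ 2%N).
  case=> [n len|_ _ /eqP]; last by rewrite subr_eq0 => /eqP.
  have := eIJH n ltac:(lia); rewrite idealXM => /lenH; rewrite HP; [|lia..].
  (* Rewrites the term e_(1,1) n^2 in the binomial basis. *)
  have : 'C(n.+1, 2)%:Z * 2 = n%:Z * (n%:Z + 1).
    elim: n {len} => // n IHn; rewrite bin2S mulrDl IHn; lia.
  by move: 'C(_, _) => B; lia.
have [N3 FE] := Ftilde_stable ab_red r0 s0 R_noetherian.
have [Mg gM] := gH r0; have [Mh hM] := hH s0.
pose den k := (a ^+ k *: (I ^+ r0 * J ^+ (s0 + k))
               + b ^+ k *: (I ^+ (r0 + k) * J ^+ s0))%ID.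
pose P k := (I ^+ (r0 + k) * J ^+ (s0 + k))%ID.
have denP k : {subset den k <= P k} by apply: M1_den_sub.
pose F := Ftilde ab_red r0 s0.
pose A := e 0%N 1%N - (g1 r0 + r0%:Z * e 1%N 1%N).
pose B := e 1%N 0%N - (h1 s0 + s0%:Z * e 1%N 1%N).
(* By additivity [colen F] stands for the difference of the two lengths in (b). *)
pose C := g2 r0 + h2 s0 + r0%:Z * s0%:Z * e 1%N 1%N
  - (colen F)%:Z - eIJ 2%N.
(* Beyond this bound [Ftilde_at] is stable and all three polynomials apply. *)
pose K := (N1 + N3 + Mg + Mh)%N.
have len_M1 k : (K <= k)%N -> (colen (den k))%:Z - (colen (P k))%:Z =
    (s0 + k)%:Z * A + (r0 + k)%:Z * B + C.
  move=> leKk; rewrite /K in leKk.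
  have [_ ] := colen_M1 r0 s0 k ab fin_ab finIJ; rewrite FE; last by lia.
  rewrite -/F -/(den k) => denE.
  have : (colen (den k))%:Z + (colen F)%:Z =
      k%:Z * k%:Z * lam + H r0 (s0 + k)%N + H (r0 + k)%N s0.
    by rewrite /lam /H; lia.
  have : (colen (P k))%:Z = H (r0 + k)%N (s0 + k)%N by [].
  (* The equalities of leading coefficients cancel all terms quadratic in k. *)
  rewrite gM ?hM ?HP; [|lia..]; rewrite lamE e00E e02E e20E /A /B /C.
  by move: 'C(_, _) 'C(_, _) => X Y; lia.
have fin_den k : cofin (den k) by have [] := colen_M1 r0 s0 k ab fin_ab finIJ.
have M1_eq0 k : (K <= k)%N ->
    {subset P k <= den k} <-> (s0 + k)%:Z * A + (r0 + k)%:Z * B + C = 0.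
  move=> leKk; rewrite -len_M1 // -(colen_leq_eq (@denP k) (fin_den k)).
  by split; lia.
have subF : {subset (I ^+ r0 * J ^+ s0)%ID <= F}.
  by move=> x xIJ; apply/asboolP; exists 1%N => //; apply: sub_Ftilde_at.
rewrite (modlength_quotm (finIJ _ _)) (modlength_subquot subF (finIJ _ _)).
tfae.
- case=> N aN.
  have sub k : (N <= k)%N -> {subset P k <= den k}
    by move=> leNk x xP; apply: (etrans (esym (aN k leNk x)) xP).
  have := sub (N + K)%N (leq_addr _ _) => /(M1_eq0 _ (leq_addl _ _)).
  have := sub (N + K).+1 (leqW (leq_addr _ _)).
  move=> /(M1_eq0 _ (leqW (leq_addl _ _))) eq1 eq0.
  (* The equations at two consecutive values of k differ by A + B. *)
  have AB0 : A + B = 0 by lia.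
  have A0 : A = 0 by have := A_ge0 lamE r0; have := B_ge0 lamE s0; lia.
  have B0 : B = 0 by lia.
  have C0 : C = 0 by move: eq0; rewrite A0 B0; lia.
  split; [by rewrite /A in A0; lia | by rewrite /B in B0; lia |].
  by congr EFin; rewrite /C in C0; lia.
- case=> A0 B0 [C0]; exists K => k leKk; apply/subquot_eq0/M1_eq0 => //.
  by rewrite /A /B A0 B0 !subrr !mulr0 !add0r /C; lia.
- case=> N cN; exists N => k leNk x; apply/idP/idP; last exact: denP.
  by apply: (subquot_eq0 (P k) (den k)).1; apply: cN.
Qed.
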